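(* There exists a polynomial of degree $5$ with rational coefficients none of whose (complex) roots can be obtained on the complex calculator. For example, $x^5-4x+2$ is such a polynomial.
   Context: A complex number $x$ can be obtained on the complex calculator if there is a finite sequence of complex numbers ending with $x$, each term of which is either $1$, or the sum, difference, product or quotient (with nonzero divisor) of two earlier terms, or any one of the complex $n$-th roots of an earlier term for some integer $n\ge 2$ (i.e. a complex number whose $n$-th power is an earlier term). *)

(* Defs.v *)
From HB Require Import structures.
From mathcomp Require Import all_boot all_order all_algebra.
From mathcomp Require Import complex reals.
Set Implicit Arguments.
Unset Strict Implicit.
Unset Printing Implicit Defensive.
Import GRing.Theory.
Local Open Scope ring_scope.

(* [s] is the list of earlier terms.  The two operands of an operation may be
   the same term, and every [n]-th root of an earlier term is allowed. *)
Definition calculator_step (K : fieldType) (s : seq K) (x : K) : Prop :=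
  [\/ x = 1,
      exists y z : K, [/\ y \in s, z \in s &
        [\/ x = y + z, x = y - z, x = y * z | z != 0 /\ x = y / z]]
    | exists (n : nat) (y : K), [/\ (2 <= n)%N, y \in s & x ^+ n = y]].

Definition calculator_sequence (K : fieldType) (s : seq K) : Prop :=
  forall i : nat, (i < size s)%N -> calculator_step (take i s) s`_i.

Definition obtainable (K : fieldType) (x : K) : Prop :=
  exists s : seq K, calculator_sequence (rcons s x).

(* The complex numbers are [R[i]] for a model [R] of the reals.  Recall that
   [size p = 6] means that [p] has degree 5. *)
Definition quintic_without_obtainable_root (R : realType) (p : {poly rat}) :
    Prop :=
  size p = 6%N /\
  forall x : R[i], root (map_poly ratr p) x -> ~ obtainable x.

(* Main.v *)
Require Import Defs.
From HB Require Import structures.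
From mathcomp Require Import all_boot all_order all_algebra.
From mathcomp Require Import complex reals boolp.
From mathcomp Require Import all_fingroup all_solvable all_field ring lra.
Set Implicit Arguments.
Unset Strict Implicit.
Unset Printing Implicit Defensive.
Import Order.TTheory GRing.Theory Num.Theory.
Local Open Scope ring_scope.

(** Suppose a calculator sequence ends with a root of q = X^5 - 4 X + 2.  All
    its terms are algebraic, so they lie, together with the five roots of q, in
    a number field L inside the complex numbers that is normal over the
    rationals (number_field_splitting).  Let G be the Galois group of L, with
    derived series G^(k).

    The whole group G^(i+1) fixes the term of index i, counting from 0
    (calculator_fixed).  Rational operations preserve this.  For a radical x
    with x^n = y and y fixed by G^(k), k > 0, every element of G^(k) multiplies x by
    an n-th root of unity; G^(1) already fixes the roots of unity, because any
    automorphism acts on a cyclic group of roots of unity by a power map; hence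
    two elements of G^(k) commute on x, and their commutators fix x
    (der_fix_radical).

    On the other hand G acts on the five roots of q as the full symmetric group
    (quintic_galois_full).  The action is transitive because q is irreducible
    by the Eisenstein criterion at 2.  Complex conjugation induces an element
    of G which fixes the real roots, and q has exactly three of them: sign
    changes give three, and four distinct real roots would have a vanishing sum
    of squares (quintic_no_4_real_roots).  So conjugation is a transposition,
    and a transitive group of prime degree with a transposition is symmetric.
    The alternating group of degree 5 is its own derived group, so the image of
    every G^(k) contains it and moves every root (der_moves_root), which
    contradicts the fact that the last term is fixed by some G^(k). *)

(** * Permutations of five points *)

Section Permutations.
Import GroupScope.
Local Open Scope nat_scope.
Local Open Scope group_scope.

(** The alternating group of degree 5 is simple, so its derived subgroup is
    trivial or everything.  In the first case it would be abelian, and the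
    subgroup generated by an element of order 3 would be normal. *)
Lemma Alt5_sub_der (T : finType) (k : nat) :
  #|T| = 5 -> 'Alt_T \subset ('Sym_T)^`(k).
Proof.
move=> T5; suff AltE m : ('Alt_T)^`(m) = 'Alt_T.
  by rewrite -{1}(AltE k); apply: dergS; apply: Alt_subset.
elim: m => [|m IHm]; first by rewrite derg0.
rewrite dergSn IHm {m IHm} -derg1.
have cardA : #|'Alt_T| = 60.
  by apply: double_inj; rewrite -mul2n card_Alt T5.
have /simpleP[_ simA] : simple 'Alt_T by apply: simple_Alt5; rewrite T5.
have [/= trivA|//] := simA ('Alt_T)^`(1)%G (der_normal _ _).
have [|x Ax ox] := @Cauchy _ 3 'Alt_T isT; first by rewrite cardA.
have nx : <[x]> <| 'Alt_T.
  by rewrite -sub_abelian_normal ?cycle_subG //; apply/derG1P.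
have := simA <[x]>%G nx => -[] /(congr1 (fun B : {set _} => #|B|)) /=;
  by rewrite -orderE ox ?cards1 ?cardA.
Qed.

Lemma Alt_moves (T : finType) (i : T) :
  2 < #|T| -> exists2 s, s \in 'Alt_T & s i != i.
Proof.
move=> T3.
have /card_gt1P[j [k [ji ki jk]]] : 1 < #|[set~ i]|.
  by rewrite cardsC1 -subn1 ltn_subRL.
rewrite !inE in ji ki.
exists (tperm i j * tperm i k).
  by rewrite Alt_even odd_permM !odd_tperm ![i == _]eq_sym ji ki.
by rewrite permM tpermL tpermD // eq_sym.
Qed.

Lemma perm_fix_all_but2 (T : finType) (s : {perm T}) (A : {set T}) :
    {in A, forall x, s x = x} -> #|T| <= #|A| + 2 -> s != 1 ->
  exists x y, x != y /\ s = tperm x y.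
Proof.
move=> fixA cardA s1.
have [x sx] : exists x, s x != x.
  apply/existsP; apply: contraNT s1 => /existsPn fix1.
  by apply/eqP/permP=> x; rewrite perm1; apply/eqP/negPn.
have sxA : ~~ (s x \in A) by apply: contra sx => /fixA/perm_inj->.
have xA : ~~ (x \in A) by apply: contra sx => /fixA->.
exists x, (s x); split; first by rewrite eq_sym.
have AC : ~: A = [set x; s x].
  apply/esym/eqP; rewrite eqEcard cards2 [x == _]eq_sym sx cardsCs setCK.
  by rewrite subUset !sub1set !inE sxA xA leq_subLR.
have fixP y : y != x -> y != s x -> s y = y.
  move=> yx ysx; apply: fixA; apply: contraR yx => yA.
  have : y \in ~: A by rewrite inE.
  by rewrite AC !inE (negPf ysx) orbF.
apply/permP=> y; case: tpermP => [->//|->|/eqP yx /eqP ysx]; last exact: fixP.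
have ssx : s (s x) != s x by rewrite (inj_eq perm_inj).
apply: contraNeq ssx => ssx_x; apply/eqP/(@perm_inj _ s)/fixP=> //.
by rewrite (inj_eq perm_inj).
Qed.

(** Transitivity makes the prime #|T| divide the order of G; an element of that
    order is a cycle through all the points. *)
Lemma transitive_tperm_full (T : finType) (G : {group {perm T}}) (x y : T) :
    prime #|T| -> [transitive G, on setT | 'P] -> x != y -> tperm x y \in G ->
  G :=: 'Sym_T.
Proof.
move=> prT trG xy Gxy.
have [|c Gc oc] := @Cauchy _ #|T| G prT.
  by rewrite -cardsT (atrans_dvd trG).
apply/eqP; rewrite eqEsubset subsetT -(gen_tperm_circular_shift prT xy oc).
by rewrite gen_subG subUset !sub1set Gxy.
Qed.

Lemma der_antitone (gT : finGroupType) (H : {group gT}) (m n : nat) :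
  m <= n -> H^`(n) \subset H^`(m).
Proof.
move=> /subnK <-; elim: (n - m)%N => // k IHk.
exact: subset_trans (der_subS _ _) IHk.
Qed.

End Permutations.

(** * Normal number fields inside the complex numbers *)

Section NumberFields.
Variable C : numClosedFieldType.
Local Notation ratC := (map_poly (ratr : rat -> C)).

Lemma algebraic_radical (n : nat) (x y : C) :
  (0 < n)%N -> x ^+ n = y -> algebraicOver ratr y -> algebraicOver ratr x.
Proof.
move=> n_gt0 xy [p p0 py]; exists (p \Po 'X^n).
  by rewrite comp_poly_eq0 // size_polyXn.
by rewrite map_comp_poly map_polyXn rootE horner_comp hornerXn xy -rootE.
Qed.

Lemma algebraic_irreducible (x : C) : algebraicOver ratr x ->
  exists2 p : {poly rat}, root (ratC p) x & irreducible_poly p.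
Proof.
move=> [p p0 px].
pose annihilator_size n :=
  `[< exists q : {poly rat}, [/\ q != 0, root (ratC q) x & size q = n] >].
have ex_ann : exists n, annihilator_size n.
  by exists (size p); apply/asboolP; exists p.
have [n /asboolP[q [q0 qx <-]] minq] := ex_minnP ex_ann.
exists q => //; apply/(subfx_irreducibleP qx q0) => r rx r0.
by apply: minq; apply/asboolP; exists r.
Qed.

(** The last clause says that z lies in the additive group generated by s.  It
    makes the field of z no larger than the field of s: the former is then a
    splitting field when s consists of all the roots of a polynomial. *)
Lemma primitive_element (s : seq C) : {in s, forall x, algebraicOver ratr x} ->
  exists z, [/\ algebraicOver ratr z,
    {in s, forall x, exists p, x = (ratC p).[z]} &
    forall S : C -> Prop, S 0 -> (forall u v, S u -> S v -> S (u - v)) ->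
      {in s, forall x, S x} -> S z].
Proof.
elim: s => [|x s IHs] algs; first by exists 0; split=> //; apply: algebraic0.
have [|y [algy sy Sy]] := IHs.
  by move=> u su; apply: algs; rewrite inE su orbT.
have algx : algebraicOver ratr x by apply: algs; rewrite mem_head.
have [p p0 px] := algx; have [q q0 qy] := algy.
have [n [[px' Dx] [py Dy]]] := pchar0_PET p0 px q0 qy (pchar_num _).
exists (y *+ n - x); split.
- apply: algebraic_sub => //; rewrite -mulr_natr; apply: algebraic_mul => //.
  by rewrite -(rmorph_nat ratr); apply: algebraic_id.
- move=> u /[!inE] /predU1P[->|/sy[r ->]]; first by exists px'.
  by exists (r \Po py); rewrite map_comp_poly horner_comp Dy.
move=> S S0 SB Ss.
have SN u : S u -> S (- u) by rewrite -sub0r; apply: (SB).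
apply: (SB); last by apply: Ss; rewrite mem_head.
elim: n {Dx Dy} => // n IHn.
rewrite mulrSr -[y in _ + y]opprK; apply: (SB) => //.
by apply: SN; apply: Sy => // u su; apply: Ss; rewrite inE su orbT.
Qed.

Lemma lift_seq (A B : eqType) (f : A -> B) (s : seq B) :
  {in s, forall x, exists y, f y = x} -> exists t, map f t = s.
Proof.
elim: s => [|x s IHs] lift; first by exists [::].
have [|t <-] := IHs; first by move=> u su; apply: lift; rewrite inE su orbT.
by have [y <-] := lift x (mem_head _ _); exists (y :: t).
Qed.

Lemma map_embedding_rat_poly (L : fieldExtType rat) (iota : {rmorphism L -> C})
    (p : {poly rat}) :
  map_poly iota (map_poly (in_alg L) p) = ratC p.
Proof.
rewrite -map_poly_comp; apply: eq_map_poly => a /=.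
by rewrite alg_num_field fmorph_rat.
Qed.

(** The field is generated by a primitive element of the field of all roots of
    p; this keeps the embedding into C explicit. *)
Lemma number_field_splitting (p : {poly rat}) : p != 0 ->
  exists (L : splittingFieldType rat) (iota : {rmorphism L -> C}) (z : L),
    <<1; z>>%VS = fullv /\
    forall x, root (ratC p) x -> exists y, iota y = x.
Proof.
move=> p0; have [rs Dp] := closed_field_poly_normal (ratC p).
have lp0 : lead_coef (ratC p) != 0 by rewrite lead_coef_eq0 map_poly_eq0.
have rsP x : root (ratC p) x = (x \in rs).
  by rewrite Dp rootZ // root_prod_XsubC.
have [|z [algz sz Sz]] := @primitive_element rs.
  by move=> x; rewrite -rsP; exists p.
have [q qz irr_q] := algebraic_irreducible algz.
pose L := SubFieldExtType qz irr_q; have q0 := irredp_neq0 irr_q.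
pose iota : {rmorphism L -> C} :=
  @subfx_inj _ _ (ratr : {rmorphism rat -> C}) z q.
pose z1 : L := subfx_root _ z q.
have iz1 : iota z1 = z by apply: subfx_inj_root.
have evz1 r : iota (map_poly (in_alg L) r).[z1] = (ratC r).[z].
  by rewrite -horner_map iz1 map_embedding_rat_poly.
have genz1 : <<1; z1>>%VS = fullv.
  apply/vspaceP=> y; rewrite memvf; apply/Fadjoin1_polyP.
  by have [r ->] := subfxEroot qz q0 y; exists r.
have liftP x : root (ratC p) x -> exists y, iota y = x.
  by rewrite rsP => /sz[r ->]; exists (map_poly (in_alg L) r).[z1].
have [|rs1 Drs] := @lift_seq _ _ iota rs.
  by move=> x; rewrite -rsP; apply: liftP.
have splitL : splitting_field_axiom L.
  exists (map_poly (in_alg L) p); first exact: alg_polyOver.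
  exists rs1.
    rewrite -(eqp_map iota) map_embedding_rat_poly map_prod_XsubC Dp -Drs big_map.
    exact: eqp_scale.
  apply/eqP; rewrite eqEsubv subvf /= -genz1.
  apply/FadjoinP; split; first exact: sub1v.
  have [|||y ys iy] := Sz (fun c => exists2 y, y \in <<1 & rs1>>%VS & iota y = c).
  - by exists 0; rewrite ?mem0v ?rmorph0.
  - move=> _ _ [u us <-] [v vs <-]; exists (u - v); last by rewrite rmorphB.
    by rewrite memvB.
  - move=> x; rewrite -Drs => /mapP[y ys ->]; exists y => //.
    exact: seqv_sub_adjoin.
  by rewrite -[z1](fmorph_inj iota (etrans iy (esym iz1))).
pose LS : splittingFieldType rat :=
  HB.pack L (FieldExt_isSplittingField.Build rat L splitL).
by exists LS, iota, z1.
Qed.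

Lemma gal_rat_poly (L : splittingFieldType rat) (g : gal_of {:L})
    (p : {poly rat}) :
  map_poly g (map_poly (in_alg L) p) = map_poly (in_alg L) p.
Proof.
by rewrite -map_poly_comp; apply: eq_map_poly => a /=; rewrite linearZ rmorph1.
Qed.

(** An automorphism sigma of C sends a primitive element z to another root of
    its minimal polynomial.  By normality that root is the image of z under an
    element of the Galois group, which then agrees with sigma on L. *)
Lemma restrict_automorphism (L : splittingFieldType rat)
    (iota : {rmorphism L -> C}) (z : L) (sigma : {rmorphism C -> C}) :
    <<1; z>>%VS = fullv ->
  exists g : gal_of {:L}, forall y, iota (g y) = sigma (iota y).
Proof.
move=> genz; have nL := normalFieldf (L := L) 1.
have [r Dr] := polyOver1P (minPolyOver 1%AS z).
have [gs _ Dgs] := elimT (@normalField_factors _ L 1%AS {:L}%AS (sub1v _)) nL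
  z (memvf z).
have sigma_rat q : map_poly sigma (ratC q) = ratC q.
  by rewrite -map_poly_comp; apply: eq_map_poly => a /=; rewrite fmorph_rat.
have : root (ratC r) (sigma (iota z)).
  rewrite -sigma_rat -(map_embedding_rat_poly iota) -Dr.
  by rewrite !rmorph_root // root_minPoly.
rewrite -(map_embedding_rat_poly iota) -Dr Dgs map_prod_XsubC.
rewrite -[\prod_(_ <- _) _](big_map (fun g : gal_of {:L} => iota (g z))
  xpredT (fun c => 'X - c%:P)).
rewrite root_prod_XsubC => /mapP[g _ sz]; exists g => y.
have /Fadjoin1_polyP[p ->] : y \in <<1; z>>%VS by rewrite genz memvf.
rewrite -!horner_map gal_rat_poly /= map_embedding_rat_poly -sz.
by rewrite sigma_rat.
Qed.

End NumberFields.

(** * The derived series of a Galois group and radicals *)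

Section DerivedSeries.
Variable L : splittingFieldType rat.
Local Notation G := [set: gal_of {:L}]%G.

Lemma fix_group_set (x : L) : group_set [set g : gal_of {:L} | g x == x].
Proof.
apply/group_setP; split=> [|g h]; rewrite !inE ?gal_id // => /eqP gx /eqP hx.
by rewrite galM ?memvf // gx hx.
Qed.

Definition fix_group (x : L) : {group gal_of {:L}} := Group (fix_group_set x).

Lemma commutator_fix (H : {group gal_of {:L}}) (x : L) :
    (forall g h, g \in H -> h \in H -> g (h x) = h (g x)) ->
  [~: H, H]%g \subset fix_group x.
Proof.
move=> comm; rewrite gen_subG; apply/subsetP=> _ /imset2P[g h Hg Hh ->].
(* The product of g^-1 and h^-1 comes first in the commutator and acts on x
   itself; the rest of the commutator undoes it in the other order. *)
have commV : ((g^-1 * h^-1) x = (h^-1 * g^-1) x)%g.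
  by rewrite !galM ?memvf // comm ?groupV.
rewrite inE /commg /conjg mulgA mulgA -mulgA galM ?memvf // commV.
by rewrite -galM ?memvf // -mulgA mulKg mulVg gal_id.
Qed.

(** Automorphisms raise u to powers, and power maps commute. *)
Lemma der1_fix_unity_root (n : nat) (u : L) : (0 < n)%N -> u ^+ n = 1 ->
  (G^`(1))%g \subset fix_group u.
Proof.
move=> n_gt0 un; have [m prim_u _] := prim_order_exists n_gt0 un.
rewrite derg1; apply: commutator_fix => g h _ _.
have pow (k : gal_of {:L}) : exists i, k u = u ^+ i.
  have : k u ^+ m = 1 by rewrite -rmorphXn (prim_expr_order prim_u) rmorph1.
  by case/(prim_rootP prim_u) => i ->; exists i.
have [i gi] := pow g; have [j hj] := pow h.
by rewrite gi hj !rmorphXn /= gi hj -!exprM mulnC.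
Qed.

(** The radicand is assumed fixed by a positive term of the derived series, so
    that this term also fixes the roots of unity by which it multiplies x. *)
Lemma der_fix_radical (k n : nat) (x y : L) : (0 < n)%N -> x ^+ n = y ->
    (G^`(k.+1))%g \subset fix_group y ->
  (G^`(k.+2))%g \subset fix_group x.
Proof.
move=> n_gt0 xn fixy; rewrite dergSn; apply: commutator_fix => g h Gg Gh.
have [->|x0] := eqVneq x 0; first by rewrite !rmorph0.
have unit_mul (f : gal_of {:L}) : f \in (G^`(k.+1))%g ->
    exists2 u, f x = u * x & u ^+ n = 1.
  move=> Gf; exists (f x / x); first by rewrite divfK.
  have := subsetP fixy f Gf; rewrite inE => /eqP fy.
  by rewrite expr_div_n -rmorphXn /= xn fy -xn divff ?expf_neq0.
have fix_unit (f : gal_of {:L}) u : f \in (G^`(k.+1))%g -> u ^+ n = 1 -> f u = u.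
  move=> Gf un; have := subsetP (der1_fix_unity_root n_gt0 un) f.
  rewrite inE => /(_ _)/eqP; apply; apply: subsetP Gf.
  exact: der_antitone.
have [u gx un] := unit_mul g Gg; have [v hx vn] := unit_mul h Gh.
rewrite gx hx !rmorphM /= (fix_unit g v) ?(fix_unit h u) //.
by rewrite gx hx mulrCA.
Qed.

End DerivedSeries.

(** * Obtainable numbers *)

Section Obtainable.
Variable C : numClosedFieldType.
Local Notation ratC := (map_poly (ratr : rat -> C)).

Lemma mem_take_nth (T : eqType) (x0 : T) (s : seq T) (i : nat) (y : T) :
  (i < size s)%N -> y \in take i s -> exists2 j, (j < i)%N & y = nth x0 s j.
Proof.
move=> lt_i /(nthP x0)[j]; rewrite size_take lt_i => ltji <-.
by exists j; rewrite // nth_take.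
Qed.

Lemma calculator_algebraic (s : seq C) : calculator_sequence s ->
  {in s, forall x, algebraicOver ratr x}.
Proof.
move=> calc _ /(nthP 0)[i lti <-]; elim/ltn_ind: i lti => i IHi lti.
have alg_take y : y \in take i s -> algebraicOver ratr y.
  case/(mem_take_nth 0 lti) => j ltji ->.
  by apply: IHi => //; apply: ltn_trans lti.
case: (calc i lti) => [->|[y [z [/alg_take ay /alg_take az]]]|
                       [n [y [n2 /alg_take ay xn]]]].
- exact: algebraic1.
- case=> [->|->|->|[_ ->]]; [exact: algebraic_add | exact: algebraic_sub
   | exact: algebraic_mul | exact: algebraic_div].
- by apply: algebraic_radical xn ay; apply: ltnW.
Qed.

Lemma common_annihilator (s : seq C) :
    {in s, forall x, algebraicOver ratr x} ->
  exists2 p : {poly rat}, p != 0 & {in s, forall x, root (ratC p) x}.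
Proof.
elim: s => [|x s IHs] algs; first by exists 1; rewrite ?oner_eq0.
have [|p p0 ps] := IHs; first by move=> y sy; apply: algs; rewrite inE sy orbT.
have [q q0 qx] := algs x (mem_head _ _).
exists (q * p); first by rewrite mulf_neq0.
by move=> y /[!inE] /predU1P[->|/ps py]; rewrite rmorphM rootM ?qx ?py ?orbT.
Qed.

(** One step of the calculator costs at most one step of the derived series. *)
Lemma calculator_fixed (L : splittingFieldType rat) (iota : {rmorphism L -> C})
    (s : seq C) : calculator_sequence s ->
    {in s, forall x, exists y, iota y = x} ->
  forall (i : nat) (x : L), (i < size s)%N -> iota x = s`_i ->
    ([set: gal_of {:L}]^`(i.+1))%g \subset fix_group x.
Proof.
move=> calc lift i; elim/ltn_ind: i => i IHi x lti Dx.
(* The radical case is settled here, where the index of the radicand is at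
   hand: its group has a positive index, as der_fix_radical requires. *)
have fixed_take c : c \in take i s -> exists y, [/\ iota y = c,
    ([set: gal_of {:L}]^`(i))%g \subset fix_group y &
    forall n, (0 < n)%N -> x ^+ n = y ->
      ([set: gal_of {:L}]^`(i.+1))%g \subset fix_group x].
  move=> ic; have [j ltji Dc] := mem_take_nth 0 lti ic.
  have [y Dy] := lift c (mem_take ic).
  have fixy : ([set: gal_of {:L}]^`(j.+1))%g \subset fix_group y.
    by apply: (IHi j ltji _ (ltn_trans ltji lti)); rewrite Dy.
  exists y; split=> // [|n n_gt0 xn].
    exact: subset_trans (der_antitone _ ltji) fixy.
  apply: subset_trans (der_fix_radical n_gt0 xn fixy).
  exact: der_antitone.
have fix_op (op : L -> L -> L) u v : x = op u v ->
    (forall g : gal_of {:L}, g (op u v) = op (g u) (g v)) ->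
    ([set: gal_of {:L}]^`(i))%g \subset fix_group u ->
    ([set: gal_of {:L}]^`(i))%g \subset fix_group v ->
    ([set: gal_of {:L}]^`(i.+1))%g \subset fix_group x.
  move=> -> gop fixu fixv; apply: subset_trans (der_subS _ _) _.
  apply/subsetP=> g Gg; rewrite inE gop.
  have := subsetP fixu g Gg; have := subsetP fixv g Gg.
  by rewrite !inE => /eqP-> /eqP->.
case: (calc i lti); rewrite -Dx.
- rewrite -(rmorph1 iota) => /fmorph_inj->; apply/subsetP=> g _.
  by rewrite inE rmorph1.
- move=> [_ [_ [/fixed_take[u [<- fixu _]] /fixed_take[v [<- fixv _]]]]].
  case=> [||| [_]].
  + rewrite -rmorphD => /fmorph_inj Dop.
    by apply: fix_op Dop _ fixu fixv => g; rewrite rmorphD.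
  + rewrite -rmorphB => /fmorph_inj Dop.
    by apply: (fix_op (fun a b => a - b)) Dop _ fixu fixv => g; rewrite rmorphB.
  + rewrite -rmorphM => /fmorph_inj Dop.
    by apply: fix_op Dop _ fixu fixv => g; rewrite rmorphM.
  + rewrite -fmorph_div => /fmorph_inj Dop.
    by apply: (fix_op (fun a b => a / b)) Dop _ fixu fixv => g; rewrite fmorph_div.
- move=> [n [_ [n2 /fixed_take[y [<- _ fixx]]]]].
  by rewrite -rmorphXn => /fmorph_inj; apply: fixx; apply: ltnW.
Qed.

End Obtainable.

(** * The Galois action on the roots of a rational polynomial *)

Section GaloisActionOnRoots.
Variables (L : splittingFieldType rat) (n : nat) (rs : n.-tuple L).
Variable p : {poly rat}.
Hypothesis rs_uniq : uniq rs.
Hypothesis rsP : forall x, root (map_poly (in_alg L) p) x = (x \in rs).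
Local Notation G := [set: gal_of {:L}]%G.

Lemma gal_root_index (g : gal_of {:L}) (i : 'I_n) :
  exists j, tnth rs j == g (tnth rs i).
Proof.
have /tnthP[j Dj] : g (tnth rs i) \in rs.
  by rewrite -rsP -(gal_rat_poly g) rmorph_root // rsP mem_tnth.
by exists j; rewrite Dj.
Qed.

Definition gal_index g i := xchoose (gal_root_index g i).

Lemma gal_indexE g i : tnth rs (gal_index g i) = g (tnth rs i).
Proof. exact/eqP/(xchooseP (gal_root_index g i)). Qed.

Lemma gal_index_inj g : injective (gal_index g).
Proof.
move=> i j /(congr1 (tnth rs)); rewrite !gal_indexE => /fmorph_inj.
exact: (tuple_uniqP _ rs_uniq).
Qed.

Definition gal_perm g : {perm 'I_n} := perm (@gal_index_inj g).

Lemma gal_permE g i : tnth rs (gal_perm g i) = g (tnth rs i).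
Proof. by rewrite permE gal_indexE. Qed.

Lemma gal_permM : {in G &, {morph gal_perm : g h / (g * h)%g}}.
Proof.
move=> g h _ _; apply/permP=> i; apply: (tuple_uniqP _ rs_uniq).
by rewrite permM !gal_permE galM ?memvf.
Qed.

Canonical gal_perm_morphism := Morphism gal_permM.

Lemma gal_perm_trans (i : 'I_n) : irreducible_poly p ->
  [transitive gal_perm @* G, on setT | 'P]%g.
Proof.
move=> irr_p; apply/imsetP; exists i => //; apply/esym/eqP.
rewrite -subTset; apply/subsetP=> j _.
have min_root : root (minPoly 1 (tnth rs i)) (tnth rs j).
  have [r Dr] := polyOver1P (minPolyOver 1%AS (tnth rs i)).
  have : minPoly 1 (tnth rs i) %| map_poly (in_alg L) p.
    by rewrite minPoly_dvdp ?alg_polyOver // rsP mem_tnth.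
  rewrite Dr dvdp_map => /irr_p.2 rp.
  have /eqp_root-> : map_poly (in_alg L) r %= map_poly (in_alg L) p.
    rewrite eqp_map rp // -(size_map_poly (in_alg L)) -Dr size_minPoly.
    by rewrite eqSS -lt0n.
  by rewrite rsP mem_tnth.
have [g _ gi] := normalField_root_minPoly (sub1v _) (normalFieldf 1)
  (memvf _) min_root.
apply/orbitP; exists (gal_perm g); first by rewrite mem_morphim ?inE.
by apply: (tuple_uniqP _ rs_uniq); rewrite /= apermE gal_permE.
Qed.

Lemma der_moves_root (k : nat) (i : 'I_n) :
    n = 5 -> (gal_perm @* G)%g = ('Sym_('I_n))%g ->
  ~~ ((G^`(k))%g \subset fix_group (tnth rs i)).
Proof.
move=> n5 full; have [|s alt_s si] := @Alt_moves _ i.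
  by rewrite card_ord n5.
have : (s \in gal_perm @* G^`(k))%g.
  rewrite morphim_der ?subsetT // full; apply: subsetP alt_s.
  by apply: Alt5_sub_der; rewrite card_ord.
case/morphimP=> g _ Gg Ds; apply: contra si => /subsetP/(_ g Gg).
rewrite inE => /eqP gi.
by apply/eqP/(tuple_uniqP _ rs_uniq); rewrite Ds gal_permE.
Qed.

End GaloisActionOnRoots.

(** * The quintic X^5 - 4 X + 2 *)

Section Quintic.

Definition quintic (A : nzRingType) : {poly A} := 'X^5 - 4%:R *: 'X + 2%:R%:P.

Lemma size_quintic (A : nzRingType) : size (quintic A) = 6%N.
Proof.
have small : (size (- (4%:R *: 'X) + 2%:R%:P : {poly A})%R < 6)%N.
  rewrite (leq_ltn_trans (size_polyD _ _)) // gtn_max size_polyN.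
  rewrite (leq_ltn_trans (size_scale_leq _ _)) ?size_polyX //.
  by rewrite (leq_ltn_trans (size_polyC_leq1 _)).
by rewrite /quintic -addrA size_polyDl size_polyXn.
Qed.

Lemma map_quintic (A B : nzRingType) (f : {rmorphism A -> B}) :
  map_poly f (quintic A) = quintic B.
Proof.
rewrite /quintic rmorphD rmorphB /= map_polyXn map_polyZ map_polyX map_polyC /=.
by rewrite !rmorph_nat.
Qed.

Lemma horner_quintic (A : nzRingType) (x : A) :
  (quintic A).[x] = x ^+ 5 - 4 * x + 2.
Proof. by rewrite !(hornerD, hornerN, hornerZ, hornerX, hornerC, hornerXn). Qed.

Lemma rmorph_quintic_value (A B : nzRingType) (f : {rmorphism A -> B}) (x : A) :
  f (x ^+ 5 - 4 * x + 2) = f x ^+ 5 - 4 * f x + 2.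
Proof. by rewrite rmorphD rmorphB rmorphXn rmorphM !rmorph_nat. Qed.

Lemma monic_quintic (A : nzRingType) : quintic A \is monic.
Proof.
rewrite monicE lead_coefE size_quintic.
rewrite !(coefD, coefN, coefZ, coefX, coefC, coefXn) /=.
by rewrite mulr0 subr0 addr0.
Qed.

Lemma quintic_irreducible : irreducible_poly (quintic rat).
Proof.
rewrite -(map_quintic intr); apply/irreducible_rat_int.
have sz := size_quintic int.
apply: (@eisenstein_crit 2) => //; first by rewrite sz.
- by rewrite (monicP (monic_quintic _)).
- by rewrite !(coefD, coefN, coefZ, coefX, coefC, coefXn).
rewrite sz => -[|[|[|[|[|i]]]]] // _;
  by rewrite !(coefD, coefN, coefZ, coefX, coefC, coefXn).
Qed.

Lemma quintic_separable : separable_poly (quintic rat).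
Proof.
rewrite unlock (irreducible_poly_coprime _ quintic_irreducible).
have sz' : size (quintic rat)^`() = 5%N.
  rewrite derivD derivB derivXn derivZ derivX derivC addr0 /=.
  have lt1 : (size (- 4%:R *: 1 : {poly rat})%R < 5)%N.
    by rewrite (leq_ltn_trans (size_scale_leq _ _)) // size_poly1.
  rewrite -scaleNr -scaler_nat.
  have sz4 : size (5%:R *: 'X^4 : {poly rat}) = 5%N.
    by rewrite size_scale ?size_polyXn // pnatr_eq0.
  by rewrite size_polyDl sz4.
by rewrite gtNdvdp // -?size_poly_eq0 sz' ?size_quintic.
Qed.

(** The values of the quintic at -2, 0, 1, 2 are -22, 2, -1, 26. *)
Lemma quintic_real_roots (R : rcfType) : exists a b c : R, [/\ a < b, b < c &
  forall x, x \in [:: a; b; c] -> x ^+ 5 - 4 * x + 2 = 0].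
Proof.
have [a /andP[_ a0] /rootP] : exists2 x, -2 <= x <= 0 & root (quintic R) x.
  by apply: poly_ivt; rewrite ?horner_quintic; lra.
have [b /andP[b0 b1] /rootP] : exists2 x, 0 <= x <= 1 & root (- quintic R) x.
  by apply: poly_ivt; rewrite ?hornerN ?horner_quintic; lra.
have [c /andP[c1 _] /rootP] : exists2 x, 1 <= x <= 2 & root (quintic R) x.
  by apply: poly_ivt; rewrite ?horner_quintic; lra.
rewrite hornerN !horner_quintic => qc /eqP; rewrite oppr_eq0 => /eqP qb qa.
exists a, b, c; split.
- apply: lt_le_trans b0; rewrite lt_neqAle a0 andbT.
  by apply: contra_eq_neq qa => ->; rewrite expr0n /= gt_eqF //; lra.
- apply: lt_le_trans c1; rewrite lt_neqAle b1 andbT.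
  by apply: contra_eq_neq qb => ->; rewrite expr1n lt_eqF //; lra.
by move=> x /[!inE] /or3P[] /eqP->.
Qed.

(** The successive divided differences of the quintic at roots a, b, c, d
    vanish.  The third one is the complete homogeneous polynomial h of degree 2
    in a, b, c, d, and 2 h = a^2 + b^2 + c^2 + d^2 + (a + b + c + d)^2. *)
Lemma quintic_no_4_real_roots (R : realFieldType) (a b c d : R) :
    uniq [:: a; b; c; d] ->
    (forall x, x \in [:: a; b; c; d] -> x ^+ 5 - 4 * x + 2 = 0) ->
  False.
Proof.
rewrite /= !inE !negb_or => /and4P[/and3P[ab ac ad] /andP[bc bd] cd _] root4.
have [qa qb qc qd] : [/\ a ^+ 5 - 4 * a + 2 = 0, b ^+ 5 - 4 * b + 2 = 0,
    c ^+ 5 - 4 * c + 2 = 0 & d ^+ 5 - 4 * d + 2 = 0].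
  by split; apply: root4; rewrite !inE eqxx ?orbT.
have diff1 (y : R) : a != y -> y ^+ 5 - 4 * y + 2 = 0 ->
    a ^+ 4 + a ^+ 3 * y + a ^+ 2 * y ^+ 2 + a * y ^+ 3 + y ^+ 4 - 4 = 0.
  rewrite -subr_eq0 => ay qy; apply: (mulfI ay).
  by rewrite mulr0 -[RHS](subrr 0) -{1}qa -qy; ring.
have diff2 (y : R) : a != y -> b != y -> y ^+ 5 - 4 * y + 2 = 0 ->
    a ^+ 3 + a ^+ 2 * (b + y) + a * (b ^+ 2 + b * y + y ^+ 2)
      + b ^+ 3 + b ^+ 2 * y + b * y ^+ 2 + y ^+ 3 = 0.
  rewrite -[b == y]subr_eq0 => ay b_y qy; apply: (mulfI b_y).
  by rewrite mulr0 -[RHS](subrr 0) -{1}(diff1 b ab qb) -(diff1 y ay qy); ring.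
have diff3 : a ^+ 2 + b ^+ 2 + c ^+ 2 + d ^+ 2
    + a * b + a * c + a * d + b * c + b * d + c * d = 0.
  rewrite -subr_eq0 in cd; apply: (mulfI cd).
  rewrite mulr0 -[RHS](subrr 0) -{1}(diff2 c ac bc qc) -(diff2 d ad bd qd).
  by ring.
have sum_sqr :
    a ^+ 2 + b ^+ 2 + (c ^+ 2 + d ^+ 2 + (a + b + c + d) ^+ 2) = 0.
  by rewrite -[RHS](mulr0 2) -diff3; ring.
move: sum_sqr => /eqP; rewrite !paddr_eq0 ?addr_ge0 ?sqr_ge0 //.
move=> /andP[/andP[]]; rewrite !sqrf_eq0 => /eqP a0 /eqP b0 _.
by move: ab; rewrite a0 b0 eqxx.
Qed.

End Quintic.

(** * The Galois group of the quintic *)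

Section QuinticGalois.
Variable R : realType.
Local Notation C := R[i].
Variables (L : splittingFieldType rat) (iota : {rmorphism L -> C}).
Hypothesis lift : forall x : C, root (quintic C) x -> exists y, iota y = x.

Lemma root_embedded_quintic (x : L) :
  root (quintic C) (iota x) = root (map_poly (in_alg L) (quintic rat)) x.
Proof.
by rewrite -(fmorph_root iota) map_embedding_rat_poly map_quintic.
Qed.

Lemma quintic_roots : exists rs : 5.-tuple L, uniq rs /\
  forall x, root (map_poly (in_alg L) (quintic rat)) x = (x \in rs).
Proof.
have [rc Drc] := closed_field_poly_normal (quintic C).
rewrite (monicP (monic_quintic _)) scale1r in Drc.
have size_rc : size rc = 5.
  by apply: succn_inj; rewrite -(size_prod_XsubC _ id) -Drc size_quintic.
have uniq_rc : uniq rc.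
  rewrite -separable_prod_XsubC -Drc -(map_quintic (ratr : {rmorphism rat -> C})).
  by rewrite separable_map quintic_separable.
have rcP x : root (quintic C) x = (x \in rc) by rewrite Drc root_prod_XsubC.
have [|rs Drs] := @lift_seq _ _ iota rc.
  by move=> x; rewrite -rcP; apply: lift.
have size_rs : size rs == 5 by rewrite -(size_map iota) Drs size_rc.
exists (Tuple size_rs); split.
  by rewrite -(map_inj_uniq (fmorph_inj iota)) Drs.
move=> x; rewrite -root_embedded_quintic rcP -Drs.
by rewrite (mem_map (fmorph_inj iota)).
Qed.

Lemma quintic_galois_full (z : L) (rs : 5.-tuple L) (rs_uniq : uniq rs)
    (rsP : forall x,
       root (map_poly (in_alg L) (quintic rat)) x = (x \in rs)) :
    <<1; z>>%VS = fullv ->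
  (gal_perm rs_uniq rsP @* [set: gal_of {:L}])%g = ('Sym_('I_5))%g.
Proof.
move=> genz.
have [g conj_g] := restrict_automorphism iota (conjc : {rmorphism C -> C}) genz.
set s := gal_perm rs_uniq rsP g.
pose x_ i := iota (tnth rs i).
have x_inj : injective x_ by move=> i j /fmorph_inj/(tuple_uniqP _ rs_uniq).
have conj_x i : x_ (s i) = (x_ i)^*%C by rewrite /x_ gal_permE conj_g.
have root_x i : x_ i ^+ 5 - 4 * x_ i + 2 = 0.
  rewrite -horner_quintic; apply/rootP.
  by rewrite root_embedded_quintic rsP mem_tnth.
have x_surj (c : C) : c ^+ 5 - 4 * c + 2 = 0 -> exists i, x_ i = c.
  rewrite -horner_quintic => /rootP qc; have [y Dy] := lift qc.
  have /tnthP[i Di] : y \in rs by rewrite -rsP -root_embedded_quintic Dy.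
  by exists i; rewrite /x_ -Di.
have fixed_real (r : R) : r ^+ 5 - 4 * r + 2 = 0 ->
    exists2 i, x_ i = real_complex R r & s i = i.
  move=> qr; have [|i xi] := x_surj (real_complex R r).
    by rewrite -(rmorph_quintic_value (real_complex R)) qr rmorph0.
  by exists i => //; apply: x_inj; rewrite conj_x xi; apply: conjc_real.
have s1 : s != 1%g.
  apply/eqP => s1.
  have real_x i : x_ i = real_complex R (complex.Re (x_ i)).
    have := conj_x i; rewrite s1 perm1; case: (x_ i) => u v [/eqP].
    by rewrite -addr_eq0 -mulr2n mulrn_eq0 /= => /eqP->.
  pose r i := complex.Re (x_ i).
  have r_inj : injective r.
    by move=> i j rij; apply: x_inj; rewrite real_x -/(r i) rij -real_x.
  have root_r i : r i ^+ 5 - 4 * r i + 2 = 0.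
    apply: (fmorph_inj (real_complex R)).
    by rewrite rmorph_quintic_value rmorph0 /= -real_x root_x.
  pose four : seq 'I_5 := [:: 0; 1; 2%:R; 3%:R].
  apply: (@quintic_no_4_real_roots R (r 0) (r 1) (r 2%:R) (r 3%:R)).
    by rewrite -[[:: _; _; _; _]]/(map r four) map_inj_uniq.
  by rewrite -[[:: _; _; _; _]]/(map r four) => _ /mapP[i _ ->].
have [a [b [c [ab bc abc_root]]]] := quintic_real_roots R.
have [|i xi si] := fixed_real a; first by apply: abc_root; rewrite !inE eqxx.
have [|j xj sj] := fixed_real b.
  by apply: abc_root; rewrite !inE eqxx orbT.
have [|k xk sk] := fixed_real c.
  by apply: abc_root; rewrite !inE eqxx !orbT.
have neq u v (l m : 'I_5) :
    x_ l = real_complex R u -> x_ m = real_complex R v -> u < v -> l != m.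
  move=> xl xm; apply: contraTneq => lm.
  by move: xl; rewrite lm xm => /complexI->; rewrite ltxx.
have [||u [v [uv Ds]]] := @perm_fix_all_but2 _ s [set i; j; k] _ _ s1.
- by move=> l; rewrite !inE => /orP[/orP[]|] /eqP->.
- have ij := neq a b i j xi xj ab; have jk := neq b c j k xj xk bc.
  have ik := neq a c i k xi xk (lt_trans ab bc).
  rewrite setUC cardsU1 cards2 !inE !(eq_sym k) ij (negPf ik) (negPf jk).
  by rewrite card_ord.
apply: transitive_tperm_full uv _; first by rewrite card_ord.
- exact: gal_perm_trans quintic_irreducible.
by rewrite -Ds mem_morphim ?inE.
Qed.

End QuinticGalois.

Theorem mainTheorem3 (R : realType) :
  (exists p : {poly rat}, quintic_without_obtainable_root R p) /\
  quintic_without_obtainable_root R ('X^5 - 4%:R *: 'X + 2%:R%:P).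
Proof.
rewrite -/(quintic rat).
suff quinticP : quintic_without_obtainable_root R (quintic rat).
  by split=> //; exists (quintic rat).
split=> [|x]; first exact: size_quintic.
rewrite map_quintic => qx [s calc].
have [p p0 ps] := common_annihilator (calculator_algebraic calc).
have q0 : quintic rat != 0 by rewrite -size_poly_eq0 size_quintic.
have [L [iota [z [genz lift]]]] :=
  number_field_splitting R[i] (mulf_neq0 p0 q0).
have lift_s : {in rcons s x, forall c, exists y, iota y = c}.
  by move=> c /ps pc; apply: lift; rewrite rmorphM rootM pc.
have lift_q c : root (quintic R[i]) c -> exists y, iota y = c.
  by move=> qc; apply: lift; rewrite rmorphM rootM /= map_quintic qc orbT.
have [rs [rs_uniq rsP]] := quintic_roots lift_q.
have full := quintic_galois_full lift_q rs_uniq rsP genz.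
have [y iy] := lift_q x qx.
have /tnthP[i Dy] : y \in rs by rewrite -rsP -(root_embedded_quintic iota) iy.
have := der_moves_root (size s).+1 i erefl full.
rewrite -Dy => /negP; apply.
apply: (calculator_fixed calc lift_s); first by rewrite size_rcons.
by rewrite iy nth_rcons ltnn eqxx.
Qed.
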